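(* There exists a unique mapping (that is, a unique family, indexed by $N\in\mathcal N$, of mappings) $\Phi=(\Phi_i)_{i\in N}:\mathcal G_N\times 2^N\to\mathbb R^{|N|}$ that satisfies, for all $N\in\mathcal N$, the axioms A1–A5 below together with the initial condition $\Phi(v,\varnothing)=\mathbf 0$ for all $v\in\mathcal G_N$: **A1 (Efficiency).** $v(S)=\sum_{i\in N}\Phi_i(v,S)$ for all $v\in\mathcal G_N$ and $S\subseteq N$. **A2 (Linearity).** For all $v,v'\in\mathcal G_N$, $\alpha,\alpha'\in\mathbb R$, $S\subseteq N$ and $i\in N$: $\Phi_i(\alpha v+\alpha' v',S)=\alpha\Phi_i(v,S)+\alpha'\Phi_i(v',S)$. **A3 (Symmetry).** $\Phi_i(v^{ij},S^{ij})=\Phi_j(v,S)$ for all $v\in\mathcal G_N$, $i,j\in N$ and $S\subseteq N$. **A4 (Null-player).** For all $v\in\mathcal G_N$ and $i\in N$, if $\partial_i v\equiv 0$, then $$\Phi_j(v,S\cup\{i\})=\Phi_j(v,S)=\Phi_j(v_{-i},S)\quad\text{for all } j\in N\setminus\{i\}\text{ and } S\subseteq N\setminus\{i\},$$ where $\Phi_j(v_{-i},S)$ is the value given by the member of the family for the player set $N\setminus\{i\}$. **A5 (Independency).** For all $v\in\mathcal G_N$ and $i\in N$, the mapping $$S\mapsto \frac{\Phi_i(v,S)+\Phi_i(v,S\cup\{i\})}{2}$$ is constant over all $S\subseteq N\setminus\{i\}$. Moreover, this unique map $\Phi$ is the solution to the Poisson equation: for every $N\in\mathcal N$, $v\in\mathcal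 G_N$ and $i\in N$, the function $\Phi_i(v,\cdot)$ is the solution, with $\Phi_i(v,\varnothing)=0$, of $$\Phi_i(v,S)-\frac1{|N|}\sum_{T\sim S}\Phi_i(v,T)=\frac1{|N|}\sum_{T\sim S}\partial_i v(T,S)\qquad\text{for all } S\subseteq N.$$
   Context: Let $\mathcal U$ be a countably infinite set (universe of players) and $\mathcal N$ the set of all finite subsets of $\mathcal U$. For $N\in\mathcal N$, the set of coalition games on $N$ is $\mathcal G_N=\{v:2^N\to\mathbb R\mid v(\varnothing)=0\}$, where $2^N$ is the set of all subsets of $N$. Values in $\mathbb R^{|N|}$ are indexed by the players $i\in N$. Hypercube graph: the vertices are the subsets of $N$. The forward edges are $\mathcal E=\{(S,S\cup\{i\}) : i\in N,\ S\subseteq N\setminus\{i\}\}$, the reverse edges are $\mathcal E_-=\{(S\cup\{i\},S): i\in N,\ S\subseteq N\setminus\{i\}\}$, and $\overline{\mathcal E}=\mathcal E\cup\mathcal E_-$. We write $T\sim S$ if $T$ and $S$ are adjacent, i.e. $(T,S)\in\overline{\mathcal E}$. Partial differential: for $v\in\mathcal G_N$ and $i\in N$, $\partial_i v:\overline{\mathcal E}\to\mathbb R$ is defined, for $j\in N$ and $S\subseteq N\setminus\{j\}$, by $\partial_i v(S,S\cup\{j\})=v(S\cup\{i\})-v(S)$ if $j=i$, and $\partial_i v(S,S\cup\{j\})=0$ if $j\ne i$; and $\partial_i v(S\cup\{j\},S)=-\partial_i v(S,S\cup\{j\})$. Thus $\partial_i v\equiv 0$ means $v(S\cup\{i\})=v(S)$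 for all $S\subseteq N\setminus\{i\}$. Swaps: for $i,j\in N$ and $S\subseteq N$, $S^{ij}$ is $S$ if $\{i,j\}\cap S=\varnothing$ or $\{i,j\}\subseteq S$; it is $(S\cup\{i\})\setminus\{j\}$ if $i\notin S$ and $j\in S$; and it is $(S\cup\{j\})\setminus\{i\}$ if $j\notin S$ and $i\in S$. For $v\in\mathcal G_N$, $v^{ij}\in\mathcal G_N$ is defined by $v^{ij}(S)=v(S^{ij})$. Restriction: for $v\in\mathcal G_N$ and $i\in N$, $v_{-i}\in\mathcal G_{N\setminus\{i\}}$ is defined by $v_{-i}(S)=v(S)$ for $S\subseteq N\setminus\{i\}$. *)

(* Defs.v *)
From HB Require Import structures.
From mathcomp Require Import all_boot all_order all_algebra.
From mathcomp Require Import finmap.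
From mathcomp Require Import boolp classical_sets functions cardinality reals.

Set Implicit Arguments.
Unset Strict Implicit.
Unset Printing Implicit Defensive.

Import Order.TTheory GRing.Theory Num.Theory.
Local Open Scope ring_scope.

Section Games.
Variables (R : realType) (U : choiceType).
Implicit Type N : {fset U}.

(* Coalitions [S] contained in [N] are elements of [{set N}], where the finite
   set [N : {fset U}] is coerced to the finite type of its elements. *)

Definition grounded N : {pred {ffun {set N} -> R^o}} :=
  [pred v : {ffun {set N} -> R^o} | v finset.set0 == 0].

Fact grounded_submod_closed N : submod_closed (@grounded N).
Proof.
split; first by rewrite inE ffunE.
by move=> a u v; rewrite !inE !ffunE => /eqP -> /eqP ->; rewrite scaler0 addr0.
Qed.

HB.instance Definition _ N :=
  GRing.isSubmodClosed.Build R {ffun {set N} -> R^o} (@grounded N)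
    (@grounded_submod_closed N).

Record game N :=
  Game { game_val :> {ffun {set N} -> R^o}; _ : game_val \in @grounded N }.

HB.instance Definition _ N := [isSub for @game_val N].
HB.instance Definition _ N := [Choice of game N by <:].
HB.instance Definition _ N := [SubChoice_isSubLmodule of game N by <:].

Section FixedPlayers.
Variable N : {fset U}.
Implicit Types (v : game N) (i j : N) (S T : {set N}).

Definition fwd_edge : rel {set N} :=
  fun S T => [exists i : N, (i \notin S) && (T == i |: S)].

Definition adj : rel {set N} := fun S T => fwd_edge S T || fwd_edge T S.

(* Only meaningful on adjacent pairs; the value elsewhere is never used. *)
Definition pdiff v i S T : R :=
  if (i \notin S) && (T == i |: S) then v (i |: S) - v S
  else if (i \notin T) && (S == i |: T) then - (v (i |: T) - v T)
  else 0.

Definition pdiff_null v i : Prop :=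
  forall S T, adj S T -> pdiff v i S T = 0.

Definition swap i j S : {set N} :=
  if ([set i; j] :&: S == finset.set0) || ([set i; j] \subset S) then S
  else if i \notin S then (i |: S) :\ j
  else (j |: S) :\ i.

Fact swap_game_subproof i j v :
  [ffun S => v (swap i j S)] \in @grounded N.
Proof. by rewrite inE ffunE /swap finset.setI0 eqxx; case: v. Qed.

Definition swap_game i j v : game N := Game (swap_game_subproof i j v).

Definition incl_player i : (N `\ val i)%fset -> N :=
  fincl (fsubD1set N (val i)).

Definition incl_coal i (S : {set (N `\ val i)%fset}) : {set N} :=
  [set @incl_player i j | j in S].

Fact restrict_subproof i v :
  [ffun S => v (@incl_coal i S)] \in @grounded (N `\ val i)%fset.
Proof. by rewrite inE ffunE /incl_coal imset0; case: v. Qed.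

Definition restrict i v : game (N `\ val i)%fset :=
  Game (restrict_subproof i v).

Definition poisson v i (f : {set N} -> R) : Prop :=
  forall S, f S - (#|` N|%:R)^-1 * (\sum_(T : {set N} | adj T S) f T)
            = (#|` N|%:R)^-1 * (\sum_(T : {set N} | adj T S) pdiff v i T S).

End FixedPlayers.

(* [Phi N v S i] is the value of player [i] in the coalition [S] for [v]. *)
Definition value_family :=
  forall N : {fset U}, game N -> {set N} -> {ffun N -> R}.

Implicit Type Phi : value_family.

Definition efficiency Phi N : Prop :=
  forall (v : game N) (S : {set N}), v S = \sum_(i : N) Phi N v S i.

Definition linearity Phi N : Prop :=
  forall (v v' : game N) (a a' : R) (S : {set N}) (i : N),
    Phi N (a *: v + a' *: v') S i = a * Phi N v S i + a' * Phi N v' S i.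

Definition symmetry Phi N : Prop :=
  forall (v : game N) (i j : N) (S : {set N}),
    Phi N (swap_game i j v) (swap i j S) i = Phi N v S j.

Definition null_player Phi N : Prop :=
  forall (v : game N) (i : N), pdiff_null v i ->
  forall (j : (N `\ val i)%fset) (S : {set (N `\ val i)%fset}),
    Phi N v (i |: incl_coal S) (incl_player j)
      = Phi N v (incl_coal S) (incl_player j)
    /\ Phi N v (incl_coal S) (incl_player j)
      = Phi (N `\ val i)%fset (restrict i v) S j.

Definition independency Phi N : Prop :=
  forall (v : game N) (i : N), exists c : R, forall S : {set N}, i \notin S ->
    (Phi N v S i + Phi N v (i |: S) i) / 2 = c.

Definition initial_condition Phi N : Prop :=
  forall v : game N, Phi N v finset.set0 = 0.

Definition value_axioms Phi : Prop := forall N : {fset U},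
  [/\ efficiency Phi N, linearity Phi N & symmetry Phi N] /\
  [/\ null_player Phi N, independency Phi N & initial_condition Phi N].

End Games.

(* Main.v *)
Require Import Defs.
From HB Require Import structures.
From mathcomp Require Import all_boot all_order all_algebra.
From mathcomp Require Import finmap.
From mathcomp Require Import boolp classical_sets functions cardinality reals.
From mathcomp Require Import perm ring lra.

Set Implicit Arguments.
Unset Strict Implicit.
Unset Printing Implicit Defensive.

Import Order.TTheory GRing.Theory Num.Theory.
Local Open Scope ring_scope.

(** Multiplied by [|N|], the Poisson equation for player [i] says that the
    combinatorial Laplacian of [f] on the hypercube equals the flow
    [v S - v (S xor i)].  Two facts about the Laplacian carry everything: its
    kernel consists of the constants (the Dirichlet energy of a harmonic function
    is zero, and the hypercube is connected), and its image consists of the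
    functions of zero sum (by dimension).  So the equation has exactly one solution
    vanishing at the empty coalition, [flow_potential v i].

    Existence.  Each axiom for the family of flow potentials is an instance of
    this uniqueness.  Efficiency holds because the flows of all players add up to
    the Laplacian of [v]; independency because the flow of [i] is odd under
    [S |-> S xor i], so that [f S + f (S xor i)] is harmonic.  Symmetry and the
    null-player axiom are both consequences of [flow_potential_pullback]: along an
    injection [h] of player sets that misses only null players, the potential is
    pulled back.  For symmetry [h] is a transposition, for the null-player axiom
    it is the inclusion of the remaining players.

    Uniqueness.  By linearity two solutions of the axioms need only be compared on
    unanimity games, by induction on the number of players.  If the unanimous
    coalition is not all of [N], a player outside it is null; removing that player
    settles the values of all the others, and efficiency then settles his.  For
    the unanimity game of [N] itself, which is invariant under all swaps, the
    difference [D] of the two values is a symmetric value of the zero game with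
    [D S i + D (i |: S) i = c] for [i] outside [S].  If [c] is nonnegative,
    induction on the size of [S] shows that members of [S] have [D S i >= c] and the others [D S i <= 0]
    ([homogeneous_value_sign]); since the entries of [D N] add up to zero, [c]
    vanishes, and the same bounds for [D] and [- D] give [D = 0]. *)

(** * The Poisson equation on the hypercube *)

Section Hypercube.
Variables (R : realFieldType) (I : finType).
Implicit Types (f g v : {set I} -> R) (S T : {set I}) (i j k : I).

(** Crossing the hypercube edge in direction [k].  Treating the two orientations
    of an edge at once makes the adjacency sum of the Poisson equation a sum over
    players. *)
Definition flip k S : {set I} := [set x | (x \in S) (+) (x == k)].

Lemma in_flip k S x : (x \in flip k S) = (x \in S) (+) (x == k).
Proof. by rewrite inE. Qed.

Lemma flipK k : involutive (flip k).
Proof. by move=> S; apply/setP=> x; rewrite !in_flip -addbA addbb addbF. Qed.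

Lemma flipC k i S : flip k (flip i S) = flip i (flip k S).
Proof. by apply/setP=> x; rewrite !in_flip -!addbA (addbC (x == i)). Qed.

Lemma flip_notin k S : k \notin S -> flip k S = k |: S.
Proof.
move=> kS; apply/setP=> x; rewrite in_flip !inE.
by have [->|_] := eqVneq x k; rewrite ?(negbTE kS) // addbF.
Qed.

Lemma flip_in k S : k \in S -> flip k S = S :\ k.
Proof.
move=> kS; apply/setP=> x; rewrite in_flip !inE.
by have [->|_] := eqVneq x k; rewrite ?kS // addbF.
Qed.

Lemma flip_inj_player S : injective (flip^~ S).
Proof.
move=> k i /setP/(_ k); rewrite !in_flip eqxx.
by have [->//|_] := eqVneq k i; case: (k \in S).
Qed.

Lemma sum_flip k f : \sum_S f (flip k S) = \sum_S f S.
Proof. by rewrite [RHS](reindex_inj (inv_inj (flipK k))). Qed.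

Definition laplacian f S : R := \sum_k (f S - f (flip k S)).

(** The right-hand side of the Poisson equation times [|N|]: at [S], only the edge
    in direction [i] carries a nonzero partial differential. *)
Definition flow v i S : R := v S - v (flip i S).

Lemma sum_laplacian f : \sum_S laplacian f S = 0.
Proof.
by rewrite exchange_big big1 // => k _; rewrite sumrB sum_flip subrr.
Qed.

Lemma sum_flow v i : \sum_S flow v i S = 0.
Proof. by rewrite sumrB sum_flip subrr. Qed.

(** Summation by parts: the Dirichlet energy, in which every edge is counted
    twice. *)
Lemma energyE f : \sum_S \sum_k (f S - f (flip k S)) ^+ 2
  = 2 * \sum_S f S * laplacian f S.
Proof.
under [X in _ = 2 * X]eq_bigr do rewrite mulr_sumr.
rewrite exchange_big [X in _ = 2 * X]exchange_big mulr_sumr /=.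
apply: eq_bigr => k _.
have E : \sum_S f (flip k S) * (f (flip k S) - f S)
         = \sum_S f S * (f S - f (flip k S)).
  rewrite -(sum_flip k (fun S => f S * (f S - f (flip k S)))).
  by apply: eq_bigr => S _; rewrite flipK.
rewrite mulr_natl mulr2n -{1}E -big_split /=.
by apply: eq_bigr => S _; ring.
Qed.

(** A harmonic function has zero energy, hence takes equal values at neighbours;
    every coalition is joined to the empty one by removing its players one at a
    time. *)
Lemma harmonic_const f :
  (forall S, laplacian f S = 0) -> forall S, f S = f finset.set0.
Proof.
move=> f0.
have: \sum_S \sum_k (f S - f (flip k S)) ^+ 2 = 0.
  by rewrite energyE big1 ?mulr0 // => S _; rewrite f0 mulr0.
have pos S : true -> 0 <= \sum_k (f S - f (flip k S)) ^+ 2.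
  by move=> _; apply: sumr_ge0 => k _; apply: sqr_ge0.
move/eqP; rewrite psumr_eq0 // => /allP E.
have ff k S : f (flip k S) = f S.
  have /E/= := mem_index_enum S.
  rewrite psumr_eq0 => [/allP/(_ k)|k' _]; last exact: sqr_ge0.
  by rewrite mem_index_enum sqrf_eq0 subr_eq0 => /(_ isT)/eqP.
move=> S; have [n] := ubnP #|S|; elim: n S => // n IHn S; rewrite ltnS => Sn.
have [->//|[k kS]] := set_0Vmem S.
rewrite -(ff k) IHn // flip_in //.
by apply: leq_trans Sn; rewrite [leqRHS](cardsD1 k) kS.
Qed.

Lemma laplacianD a b f g S :
  laplacian (fun T => a * f T + b * g T) S = a * laplacian f S + b * laplacian g S.
Proof.
by rewrite !mulr_sumr -big_split; apply: eq_bigr => k _ /=; ring.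
Qed.

Lemma laplacian_flip k f S :
  laplacian (fun T => f (flip k T)) S = laplacian f (flip k S).
Proof. by apply: eq_bigr => i _; rewrite flipC. Qed.

(** Uniqueness of the normalized solution of a Poisson equation, the source of
    every identity between flow potentials below. *)
Lemma laplacian_inj f g : f finset.set0 = g finset.set0 ->
  (forall S, laplacian f S = laplacian g S) -> forall S, f S = g S.
Proof.
move=> fg0 fg S; pose h T := 1 * f T + (-1) * g T.
have h0 T : laplacian h T = 0 by rewrite laplacianD fg; ring.
have := harmonic_const h0 S; rewrite /h fg0; lra.
Qed.

(** Adding the value at the empty coalition makes the Laplacian invertible.  Since
    Laplacians have zero sum, a preimage of a zero-sum function under this operator
    automatically vanishes at the empty coalition, so it solves the original
    equation and is already normalized. *)
Definition grounded_laplacian (f : {ffun {set I} -> R^o}) :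
  {ffun {set I} -> R^o} := [ffun S => laplacian f S + f finset.set0].

Fact grounded_laplacian_is_linear : linear grounded_laplacian.
Proof.
move=> a f g; apply/ffunP=> S; rewrite !ffunE /laplacian scalerDr addrACA.
congr (_ + _); rewrite scaler_sumr -big_split; apply: eq_bigr => k _ /=.
by rewrite !ffunE scalerBr opprD addrACA.
Qed.

HB.instance Definition _ := GRing.isLinear.Build R _ _ _ grounded_laplacian
  grounded_laplacian_is_linear.

Lemma sum_grounded_laplacian (f : {ffun {set I} -> R^o}) :
  \sum_S grounded_laplacian f S = f finset.set0 *+ #|{set I}|.
Proof.
under eq_bigr do rewrite ffunE.
by rewrite big_split /= sum_laplacian add0r sumr_const.
Qed.

Lemma card_setT_neq0 (x : R) : x *+ #|{set I}| = 0 -> x = 0.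
Proof.
move/eqP; rewrite mulrn_eq0 => /orP[/eqP/card0_eq/(_ finset.set0)|/eqP//].
by rewrite inE.
Qed.

(** [grounded_laplacian] is injective on a finite-dimensional space, hence
    surjective. *)
Lemma poisson_solvable g : \sum_S g S = 0 ->
  exists f, f finset.set0 = 0 /\ forall S, laplacian f S = g S.
Proof.
move=> g0; pose M := linfun grounded_laplacian.
have kerM : lker M == 0%VS.
  apply/lker0P => f h; rewrite !lfunE => fh.
  have f0 : f finset.set0 = h finset.set0.
    apply/eqP; rewrite -subr_eq0; apply/eqP/card_setT_neq0.
    by rewrite mulrnBl -!sum_grounded_laplacian fh subrr.
  apply/ffunP; apply: laplacian_inj => // S.
  by have /ffunP/(_ S) := fh; rewrite !ffunE f0 => /addIr.
pose f := (M^-1)%VF [ffun S => g S].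
have Mf : grounded_laplacian f = [ffun S => g S].
  by rewrite -[LHS](lfunE grounded_laplacian) lker0_lfunVK.
have f0 : f finset.set0 = 0.
  apply: card_setT_neq0; rewrite -sum_grounded_laplacian Mf -[RHS]g0.
  by apply: eq_bigr => S _; rewrite ffunE.
exists f; split=> // S.
by have /ffunP/(_ S) := Mf; rewrite !ffunE f0 addr0.
Qed.

Definition flow_potential v i : {set I} -> R :=
  projT1 (cid (poisson_solvable (sum_flow v i))).

Lemma flow_potential0 v i : flow_potential v i finset.set0 = 0.
Proof. by rewrite /flow_potential; case: cid => f []. Qed.

Lemma laplacian_flow_potential v i S :
  laplacian (flow_potential v i) S = flow v i S.
Proof. by rewrite /flow_potential; case: cid => f []. Qed.

Lemma flow_potentialP v i f : f finset.set0 = 0 ->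
  (forall S, laplacian f S = flow v i S) -> forall S, flow_potential v i S = f S.
Proof.
move=> f0 fE; apply: laplacian_inj => [|S].
  by rewrite flow_potential0.
by rewrite laplacian_flow_potential fE.
Qed.

(** The flows of all the players sum to the Laplacian of [v]. *)
Lemma flow_potential_efficient v S : v finset.set0 = 0 ->
  v S = \sum_i flow_potential v i S.
Proof.
move=> v0; apply: (laplacian_inj (g := fun S => \sum_i flow_potential v i S)).
  by rewrite v0 big1 // => i _; rewrite flow_potential0.
move=> {}S; under [LHS]eq_bigr do rewrite -/(flow v _ S).
under [LHS]eq_bigr do rewrite -laplacian_flow_potential.
by rewrite exchange_big; apply: eq_bigr => k _; rewrite sumrB.
Qed.

Lemma flow_potentialD v w a b i S :
  flow_potential (fun T => a * v T + b * w T) i S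
  = a * flow_potential v i S + b * flow_potential w i S.
Proof.
apply: (flow_potentialP
  (f := fun T => a * flow_potential v i T + b * flow_potential w i T)).
  by rewrite !flow_potential0 !mulr0 addr0.
by move=> {}S; rewrite laplacianD !laplacian_flow_potential /flow; ring.
Qed.

(** The flow of [i] changes sign across an edge in direction [i], so the left-hand
    side is harmonic in [S]; the right-hand side is its value at the empty
    coalition. *)
Lemma flow_potential_flip v i S :
  flow_potential v i S + flow_potential v i (flip i S)
  = flow_potential v i (flip i finset.set0).
Proof.
pose f T := 1 * flow_potential v i T + 1 * flow_potential v i (flip i T).
have f0 T : laplacian f T = 0.
  by rewrite laplacianD laplacian_flip !laplacian_flow_potential /flow flipK; ring.
by have := harmonic_const f0 S; rewrite /f flow_potential0 !mul1r add0r.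
Qed.

Lemma eq_flow_potential v w i S : v =1 w ->
  flow_potential v i S = flow_potential w i S.
Proof. by move=> /funext ->. Qed.

End Hypercube.

Section Pullback.
Variables (R : realFieldType) (I J : finType) (h : J -> I).
Hypothesis h_inj : injective h.

Lemma preimset_flip j S : h @^-1: flip (h j) S = flip j (h @^-1: S).
Proof. by apply/setP=> x; rewrite !(inE, in_flip) (inj_eq h_inj). Qed.

Lemma preimset_flip_out i S : i \notin codom h -> h @^-1: flip i S = h @^-1: S.
Proof.
move=> ih; apply/setP=> x; rewrite !inE.
have [E|_] := eqVneq (h x) i; last by rewrite addbF.
by rewrite -E codom_f in ih.
Qed.

(** The pulled-back potential is constant along the directions missed by [h], so
    its Laplacian only involves directions in the image of [h], where it is the
    Laplacian on [J].  This covers both relabelling the players ([h] bijective) and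
    removing null players ([h] an inclusion). *)
Lemma flow_potential_pullback (v : {set I} -> R) j S :
  (forall i T, i \notin codom h -> v (flip i T) = v T) ->
  flow_potential v (h j) S
  = flow_potential (fun T => v (h @: T)) j (h @^-1: S).
Proof.
move=> vnull; pose g (T : {set I}) := flow_potential (fun T => v (h @: T)) j (h @^-1: T).
rewrite -[RHS]/(g S); apply: flow_potentialP => [|{}S].
  by rewrite /g preimset0 flow_potential0.
(* Null players can be removed from a coalition without changing its worth. *)
have vE (T : {set I}) : v (h @: (h @^-1: T)) = v T.
  have [n] := ubnP #|T|; elim: n T => // n IHn T; rewrite ltnS => Tn.
  have [/fintype.subsetP Th|] := boolP (T \subset codom h).
    congr v; apply/setP => i; apply/imsetP/idP => [[x]|iT].
      by rewrite inE => xT ->.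
    by have /codomP[x ix] := Th _ iT; exists x; rewrite // inE -ix.
  case/subsetPn => i iT ih.
  rewrite -(preimset_flip_out _ ih) -(vnull i T) // IHn // flip_in //.
  by apply: leq_trans Tn; rewrite [leqRHS](cardsD1 i) iT.
rewrite /laplacian (bigID (fun i => i \in codom h)) /=.
rewrite [X in _ + X]big1 => [|i ih]; last first.
  by rewrite /g preimset_flip_out // subrr.
rewrite addr0.
transitivity (\sum_(k : J) (g S - g (flip (h k) S))).
  rewrite -[RHS](big_imset (A := predT) (fun i => g S - g (flip i S))) /=;
    last exact: in2W.
  apply: eq_bigl => i; apply/codomP/imsetP => [[x ->]|[x _ ->]]; by exists x.
transitivity (laplacian (flow_potential (fun T => v (h @: T)) j) (h @^-1: S)).
  by apply: eq_bigr => k _; rewrite /g preimset_flip.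
by rewrite laplacian_flow_potential /flow -preimset_flip !vE.
Qed.

End Pullback.

(** * Symmetric solutions of the homogeneous axioms *)

Section SymmetricKernel.
Variables (R : realFieldType) (I : finType).
Implicit Types (S : {set I}) (i j : I).

(** What the axioms other than linearity and the null-player axiom leave for the
    difference of two values of one swap-invariant game.  The constant of the
    independency axiom is read off at the empty coalition, where it is
    [D [set i] i]. *)
Definition homogeneous_value (D : {set I} -> I -> R) : Prop :=
  [/\ forall S, \sum_i D S i = 0,
      forall i j S, D (tperm i j @^-1: S) i = D S j,
      forall i, D finset.set0 i = 0 &
      forall i S, i \notin S -> D S i + D (i |: S) i = D [set i]%SET i].

(** By symmetry [D S] takes one value on the members of [S] and one on the
    others, and these have opposite signs because [D S] sums to zero.  If the
    members of [S] have nonnegative entries, an outsider [i] has [D S i <= 0], and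
    independency gives [D (i |: S) i = c - D S i >= c]: the bound propagates from
    size to size. *)
Lemma homogeneous_value_sign D i0 : homogeneous_value D ->
  0 <= D [set i0]%SET i0 ->
  forall S i, if i \in S then D [set i0]%SET i0 <= D S i else D S i <= 0.
Proof.
move=> [eff sym init ind]; set c := D _ _ => c0.
have cE i : D [set i]%SET i = c.
  rewrite /c -(sym i i0); congr (D _ i); apply/setP=> x.
  by rewrite !inE (canF_eq (tpermK i i0)) tpermR.
have same i j S : (i \in S) = (j \in S) -> D S i = D S j.
  move=> ij; rewrite -(sym i j); congr (D _ i); apply/setP=> x.
  by rewrite inE; case: tpermP => [->|->|].
have outside S : (forall i, i \in S -> 0 <= D S i) ->
    forall i, i \notin S -> D S i <= 0.
  move=> pos i iS; have := eff S; rewrite (bigID (mem S)) /=.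
  rewrite [X in _ + X](eq_bigr (fun=> D S i)) => [|j jS]; last first.
    by apply: same; rewrite (negbTE jS) (negbTE iS).
  rewrite sumr_const => /addr0_eq E.
  have : D S i *+ #|[pred j | j \notin S]| <= 0.
    by rewrite -E oppr_le0; apply: sumr_ge0.
  by rewrite pmulrn_lle0 //; apply/card_gt0P; exists i.
have inside n S i : (#|S| <= n)%N -> i \in S -> c <= D S i.
  elim: n S i => [|n IHn] S i Sn iS.
    by move: Sn; rewrite (cardsD1 i) iS.
  have := ind i (S :\ i); rewrite finset.setD11 finset.setD1K // cE => /(_ isT) E.
  suff : D (S :\ i) i <= 0 by lra.
  apply: outside; last by rewrite finset.setD11.
  move=> j jS; apply: le_trans c0 _; apply: IHn jS.
  by move: Sn; rewrite (cardsD1 i) iS.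
move=> S i; case: ifPn => iS; first exact: inside (leqnn _) iS.
by apply: outside => // j jS; apply: le_trans c0 _; apply: inside (leqnn _) jS.
Qed.

Lemma homogeneous_valueN D :
  homogeneous_value D -> homogeneous_value (fun S i => - D S i).
Proof.
move=> [eff sym init ind]; split=> [S|i j S|i|i S iS].
- by rewrite sumrN eff oppr0.
- by rewrite sym.
- by rewrite init oppr0.
- by rewrite -opprD ind.
Qed.

(** At the full coalition every entry is at least [c], yet they sum to zero, so
    [c] cannot be positive; by the same argument for [- D] it is zero.  The sign
    bounds for [D] and [- D] then force every entry to vanish. *)
Lemma homogeneous_value_eq0 D : homogeneous_value D -> forall S i, D S i = 0.
Proof.
move=> DP.
have c_le0 D' i : homogeneous_value D' -> D' [set i]%SET i <= 0.
  move=> D'P; rewrite leNgt; apply/negP => c0.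
  have := homogeneous_value_sign D'P (ltW c0) [set: I]%SET.
  case: D'P => /(_ [set: I]%SET) eff _ _ _ le_c.
  suff : 0 < \sum_j D' [set: I]%SET j by rewrite eff ltxx.
  have pos j : 0 < D' [set: I]%SET j.
    by have := le_c j; rewrite finset.in_setT; apply: lt_le_trans.
  by rewrite (bigD1 i) //= ltr_wpDr // sumr_ge0 // => j _; apply: ltW.
have DNP := homogeneous_valueN DP.
move=> S i; have c0 : D [set i]%SET i = 0.
  by have := c_le0 _ i DP; have := c_le0 _ i DNP; lra.
have := homogeneous_value_sign DP (i0 := i) _ S i.
have := homogeneous_value_sign DNP (i0 := i) _ S i.
rewrite c0 oppr0 => /(_ (lexx _)) + /(_ (lexx _)).
by case: ifP => _; lra.
Qed.

End SymmetricKernel.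

(** * Games, swaps and the edges of the hypercube *)

Section Games.
Variables (R : realType) (U : choiceType) (N : {fset U}).
Implicit Types (v w : game R N) (i j k : N) (S T : {set N}).

Lemma game0 v : v finset.set0 = 0.
Proof. by case: v => v /= /eqP. Qed.

Lemma gameD a b v w S : (a *: v + b *: w) S = a * v S + b * w S.
Proof. by rewrite -[LHS]/((a *: val v + b *: val w) S) !ffunE. Qed.

Lemma game_sum (J : finType) (P : pred J) (F : J -> game R N) S :
  (\sum_(j | P j) F j) S = \sum_(j | P j) F j S.
Proof.
rewrite -[LHS]/(val (\sum_(j | P j) F j) S) raddf_sum sum_ffunE.
by [].
Qed.

Lemma game_ext v w : v =1 w -> v = w.
Proof. by move=> vw; apply/val_inj/ffunP. Qed.

Lemma swapE i j S : swap i j S = tperm i j @^-1: S.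
Proof.
have [<-|ij] := eqVneq i j.
  rewrite tperm1 /swap finset.setUid finset.sub1set.
  have -> : (1%g : {perm N}) @^-1: S = S by apply/setP=> x; rewrite !inE perm1.
  have [iS|iS] := boolP (i \in S); first by rewrite orbT.
  rewrite orbF ifT //.
  apply/eqP/setP=> x; rewrite !inE.
  by have [->|//] := eqVneq x i; rewrite (negbTE iS).
apply/setP=> x; rewrite inE.
have disj : ([set i; j] :&: S == finset.set0) = (i \notin S) && (j \notin S).
  by rewrite finset.setI_eq0 disjoint_sym finset.disjoints_subset
    finset.subsetC
    finset.subUset !finset.sub1set !inE.
have ji : (j == i) = false by rewrite eq_sym (negbTE ij).
rewrite /swap disj finset.subUset !finset.sub1set.
case: tpermP => [->|->|/eqP/negbTE xi /eqP/negbTE xj];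
  have [iS|/negbTE iS] := boolP (i \in S); have [jS|/negbTE jS] := boolP (j \in S);
  rewrite ?iS ?jS /= ?inE ?eqxx ?ji ?(negbTE ij) ?iS ?jS ?xi ?xj //=.
Qed.

Lemma adj_flip k S : adj (flip k S) S.
Proof.
apply/orP; have [kS|kS] := boolP (k \in S); [left|right];
  apply/existsP; exists k.
  by rewrite flip_in // finset.setD11 finset.setD1K /= ?eqxx.
by rewrite kS flip_notin /= ?eqxx.
Qed.

Lemma adjP S T : reflect (exists k, T = flip k S) (adj T S).
Proof.
apply: (iffP idP) => [|[k ->]]; last exact: adj_flip.
case/orP => /existsP[k /andP[kS /eqP ->]]; exists k.
  by rewrite flip_in ?finset.setU11 // finset.setU1K.
by rewrite flip_notin.
Qed.

(** The neighbours of [S] are its flips, all distinct. *)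
Lemma sum_adj (F : {set N} -> R) S :
  \sum_(T | adj T S) F T = \sum_k F (flip k S).
Proof.
rewrite -[RHS](big_imset (A := predT) F) /=; last first.
  by move=> k i _ _; apply: flip_inj_player.
apply: eq_bigl => T; apply/adjP/imsetP => [[k ->]|[k _ ->]]; by exists k.
Qed.

Lemma pdiff_flip v i k S :
  pdiff v i (flip k S) S = if k == i then flow v i S else 0.
Proof.
rewrite /pdiff; have [->|ki] := eqVneq k i.
  rewrite in_flip eqxx addbT negbK /flow; case: ifPn => [/andP[iS _]|].
    by rewrite flip_in // finset.setD1K.
  have [iS|iS _] := boolP (i \in S); first by rewrite flip_in // finset.setD1K // eqxx.
  by rewrite flip_notin //= eqxx; ring.
(* Both branches of [pdiff] need [i] to separate the two coalitions. *)
have notcover (A B : {set N}) : (i \in A) = (i \in B) ->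
    (i \notin A) && (B == i |: A) = false.
  move=> AB; apply/negP => /andP[iA /eqP BA].
  by move: iA; rewrite AB BA finset.setU11.
have ik : (i \in flip k S) = (i \in S).
  by rewrite in_flip eq_sym (negbTE ki) addbF.
by rewrite (notcover _ _ ik) (notcover _ _ (esym ik)).
Qed.

Lemma poissonP v i f : poisson v i f <-> forall S, laplacian f S = flow v i S.
Proof.
have N0 : #|` N|%:R != 0 :> R.
  by rewrite pnatr_eq0 cardfE -lt0n; apply/card_gt0P; exists i.
have E S : f S - #|` N|%:R^-1 * (\sum_(T | adj T S) f T)
      = #|` N|%:R^-1 * laplacian f S.
  rewrite sum_adj /laplacian sumrB sumr_const -cardfE -(mulr_natl (f S)).
  by rewrite mulrBr mulKf.
have E' S : \sum_(T | adj T S) pdiff v i T S = flow v i S.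
  rewrite (sum_adj (fun T => pdiff v i T S)).
  under eq_bigr do rewrite pdiff_flip.
  by rewrite -big_mkcond big_pred1_eq.
by split=> H S; have := H S; rewrite E E'; [apply: mulfI; rewrite invr_eq0|move->].
Qed.

Lemma pdiff_nullP v i : pdiff_null v i <-> forall S, v (flip i S) = v S.
Proof.
split=> [H S|H S T /adjP[k ->]].
  have := H _ _ (adj_flip i S); rewrite pdiff_flip eqxx /flow => /eqP.
  by rewrite subr_eq0 => /eqP.
by rewrite pdiff_flip /flow H subrr if_same.
Qed.

Lemma incl_player_inj i : injective (@incl_player U N i).
Proof. exact: fincl_inj. Qed.

Lemma codom_incl_player i k : (k \in codom (@incl_player U N i)) = (k != i).
Proof.
apply/codomP/idP => [[x ->]|ki].
  rewrite -val_eqE /=; have := valP x; rewrite in_fsetD1.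
  by case/andP.
have kN : val k \in (N `\ val i)%fset by rewrite in_fsetD1 val_eqE ki (valP k).
by exists [` kN]%fset; apply: val_inj.
Qed.

Lemma incl_coalK i S : i \notin S ->
  incl_coal (@incl_player U N i @^-1: S) = S.
Proof.
move=> iS; apply/setP => k; apply/imsetP/idP => [[x]|kS].
  by rewrite inE => xS ->.
have : k \in codom (@incl_player U N i).
  by rewrite codom_incl_player; apply: contraNneq iS => <-.
by case/codomP => x kx; exists x; rewrite // inE -kx.
Qed.

Lemma preim_incl_coal i (S : {set (N `\ val i)%fset}) :
  @incl_player U N i @^-1: (incl_coal S) = S.
Proof.
by apply/setP => x; rewrite inE mem_imset //; apply: incl_player_inj.
Qed.

Lemma notin_incl_coal i (S : {set (N `\ val i)%fset}) : i \notin incl_coal S.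
Proof.
apply/imsetP => -[x _ ix]; have := codom_incl_player i i.
by rewrite eqxx {1}ix codom_f.
Qed.

End Games.

(** * The Poisson potentials form a value *)

Section Existence.
Variables (R : realType) (U : choiceType).

(** The family of Poisson solutions, the only candidate for the value. *)
Definition poisson_value : value_family R U :=
  fun N v S => [ffun i => flow_potential v i S].

Lemma poisson_value_axioms : value_axioms poisson_value.
Proof.
move=> N; split; split.
- move=> v S; rewrite (flow_potential_efficient S (game0 v)).
  by apply: eq_bigr => i _; rewrite ffunE.
- move=> v v' a a' S i; rewrite !ffunE -flow_potentialD.
  by apply: eq_flow_potential => T; rewrite gameD.
- move=> v i j S; rewrite !ffunE.
  transitivity (flow_potential v (tperm i j i) S); last by rewrite tpermL.
  rewrite (flow_potential_pullback (@perm_inj _ (tperm i j))) -?swapE.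
    apply: eq_flow_potential => T; rewrite ffunE swapE.
    by rewrite (can2_imset_pre _ (tpermK i j) (tpermK i j)).
  by move=> k T; rewrite -[k](tpermK i j) codom_f.
- move=> v i /pdiff_nullP vi j S; rewrite !ffunE.
  have pullback T : flow_potential v (incl_player j) T
      = flow_potential (Defs.restrict i v) j (@incl_player U N i @^-1: T).
    rewrite (flow_potential_pullback (@incl_player_inj U N i)).
      by apply: eq_flow_potential => S'; rewrite ffunE.
    by move=> k S'; rewrite codom_incl_player negbK => /eqP ->.
  rewrite -(flip_notin (notin_incl_coal S)) !pullback.
  by rewrite preimset_flip_out ?codom_incl_player ?eqxx // preim_incl_coal.
- move=> v i; exists (flow_potential v i (flip i finset.set0) / 2) => S iS.
  by rewrite !ffunE -(flow_potential_flip v i S) flip_notin.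
- by move=> v; apply/ffunP=> i; rewrite !ffunE flow_potential0.
Qed.

End Existence.

(** * The axioms determine the value *)

Section Uniqueness.
Variables (R : realType) (U : choiceType).

Section Unanimity.
Variable N : {fset U}.
Implicit Types (v w : game R N) (S T : {set N}).

(** The factor [T != set0] makes the game of the empty coalition zero, so that
    [unanimity] is a game for every [T]. *)
Fact unanimity_subproof T :
  [ffun S : {set N} => ((T != finset.set0) && (T \subset S))%:R : R^o]
    \in @grounded R U N.
Proof. by rewrite inE ffunE finset.subset0 andNb. Qed.

Definition unanimity T : game R N := Game (unanimity_subproof T).

Lemma unanimityE T S :
  unanimity T S = ((T != finset.set0) && (T \subset S))%:R.
Proof. by rewrite ffunE. Qed.

(** Unanimity games span.  If [v] vanishes on coalitions of size less than [m],
    subtracting [v T *: unanimity T] for all [T] of size [m] gives a game that also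
    vanishes at size [m]; so [v] can be exhausted level by level.  The induction
    is on the number [k] of levels left, [m] being [#|N| + 1 - k]. *)
Lemma unanimity_induction (P : game R N -> Prop) :
  (forall a b v w, P v -> P w -> P (a *: v + b *: w)) ->
  (forall T, P (unanimity T)) ->
  forall v, P v.
Proof.
move=> Plin Punan.
have P0 : P 0.
  have := Plin 0 0 _ _ (Punan finset.set0) (Punan finset.set0).
  by rewrite !scale0r addr0.
have PZ a v : P v -> P (a *: v).
  by move=> Pv; have := Plin a 0 _ _ Pv Pv; rewrite scale0r addr0.
have PD v w : P v -> P w -> P (v + w).
  by move=> Pv Pw; have := Plin 1 1 _ _ Pv Pw; rewrite !scale1r.
suff vanish k v : (forall S, (#|S| + k <= #|{: N}|)%N -> v S = 0) -> P v.
  move=> v; apply: (vanish #|{: N}|) => S.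
  rewrite -[leqRHS]add0n leq_add2r leqn0 finset.cards_eq0 => /eqP ->.
  exact: game0.
elim: k v => [|k IHk] v v0.
  suff -> : v = 0 by [].
  apply: game_ext => S; rewrite v0 ?addn0 ?max_card //.
  by rewrite -[RHS]/((0 : {ffun {set N} -> R^o}) S) ffunE.
pose w := \sum_(T : {set N} | (#|T| + k)%N == #|{: N}|) v T *: unanimity T.
rewrite -[v](subrK w); apply: (PD); last first.
  by apply: (big_ind P P0 PD) => T _; apply: PZ.
apply: IHk => S Sk.
rewrite -[w]scale1r -[v]scale1r -scaleNr gameD mul1r mulN1r.
apply/eqP; rewrite subr_eq0; apply/eqP; rewrite /w game_sum.
have term (T : {set N}) : (v T *: unanimity T) S
    = v T * ((T != finset.set0) && (T \subset S))%:R.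
  by have := gameD (v T) 0 (unanimity T) 0 S;
    rewrite scale0r addr0 mul0r addr0 unanimityE.
under eq_bigr do rewrite term.
have other (T : {set N}) : (#|T| + k)%N == #|{: N}| -> T != S ->
    v T * ((T != finset.set0) && (T \subset S))%:R = 0.
  move=> /eqP Tk TS; rewrite [_ \subset _](_ : _ = false) ?andbF ?mulr0 //.
  apply: contra_neqF TS => TS; apply/eqP.
  by rewrite eqEcard TS -(leq_add2r k) Tk.
have [SkE|SkN] := eqVneq (#|S| + k)%N #|{: N}|.
  rewrite (bigD1 S) ?SkE //= big1 => [|T /andP[]]; last exact: other.
  rewrite addr0 fintype.subxx andbT.
  by have [->|_] := eqVneq S finset.set0; rewrite ?game0 ?mul0r ?mulr1.
rewrite big1 => [|T Tk]; last first.
  by apply: other => //; apply: contraNneq SkN => <-.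
by rewrite v0 // addnS ltn_neqAle SkN.
Qed.

Lemma swap_unanimityT i j : swap_game i j (unanimity [set: N]) = unanimity [set: N].
Proof.
apply: game_ext => S; rewrite ffunE !unanimityE !finset.subTset swapE.
congr (_ && _)%:R; apply/eqP/eqP => [E|->]; last by rewrite preimsetT.
apply/setP => x; have /setP/(_ (tperm i j x)) := E.
by rewrite !inE tpermK.
Qed.

Lemma pdiff_null_unanimity T i : i \notin T -> pdiff_null (unanimity T) i.
Proof.
move=> iT; apply/pdiff_nullP => S; rewrite !unanimityE.
congr (_ && _)%:R; apply/fintype.subsetP/fintype.subsetP => TS x xT;
  have := TS _ xT; rewrite in_flip;
  have [xi|_] := eqVneq x i; rewrite ?addbF //; by rewrite -xi xT in iT.
Qed.

End Unanimity.

Lemma homogeneous_diff (Phi Psi : value_family R U) (N : {fset U}) :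
  value_axioms Phi -> value_axioms Psi ->
  homogeneous_value (fun S i => Phi N (unanimity [set: N]) S i
                                - Psi N (unanimity [set: N]) S i).
Proof.
move=> /(_ N)[[effP _ symP] [_ indP iniP]] /(_ N)[[effQ _ symQ] [_ indQ iniQ]].
set u := unanimity _; split=> [S|i j S|i|i S iS].
- by rewrite sumrB -effP -effQ subrr.
- by rewrite -swapE -(symP u i j) -(symQ u i j) swap_unanimityT.
- by rewrite iniP iniQ !ffunE subrr.
- have [c cP] := indP u i; have [d dP] := indQ u i.
  have := cP _ iS; have := dP _ iS.
  have i0 : i \notin finset.set0 by rewrite inE.
  have := cP _ i0; have := dP _ i0.
  by rewrite finset.setU0 iniP iniQ !ffunE; lra.
Qed.

(** A unanimity game either has a null player, whose removal allows induction on
    the number of players, or is the swap-invariant game of the full coalition. *)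
Lemma value_axioms_eq (Phi Psi : value_family R U) :
  value_axioms Phi -> value_axioms Psi ->
  forall N (v : game R N) S i, Phi N v S i = Psi N v S i.
Proof.
move=> axP axQ N; have [n] := ubnP #|` N|.
elim: n N => // n IHn N; rewrite ltnS => Nn.
apply: unanimity_induction => [a b v w vE wE S i|T S i].
  have [[_ linP _] _] := axP N; have [[_ linQ _] _] := axQ N.
  by rewrite linP linQ vE wE.
have [->|] := eqVneq T [set: N]%SET.
  apply/eqP; rewrite -subr_eq0; apply/eqP.
  exact: (homogeneous_value_eq0 (homogeneous_diff N axP axQ)).
rewrite -finset.subTset => /subsetPn[k _ kT].
have [[effP _ _] [nullP _ _]] := axP N; have [[effQ _ _] [nullQ _ _]] := axQ N.
have uk := pdiff_null_unanimity kT; set u := unanimity T in uk *.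
have lt_n : (#|` (N `\ val k)%fset| < n)%N.
  by apply: leq_trans Nn; rewrite [leqRHS](cardfsD1 (val k)) (valP k).
have others j : j != k -> Phi N u S j = Psi N u S j.
  rewrite -codom_incl_player => /codomP[j' ->].
  pose S' := @incl_player U N k @^-1: (S :\ k).
  have SkE : incl_coal S' = S :\ k by rewrite incl_coalK ?finset.setD11.
  have := nullP u k uk j' S'; have := nullQ u k uk j' S'.
  rewrite SkE (IHn _ lt_n) => -[Q1 Q2] [P1 P2].
  have [kS|kS] := boolP (k \in S).
    by rewrite -[S](finset.setD1K kS) Q1 P1 Q2.
  have <- : S :\ k = S by apply/finset.setDidPl; rewrite disjoint_sym finset.disjoints1.
  by rewrite P2 Q2.
have [->|] := eqVneq i k; last exact: others.
have := effP u S; rewrite (effQ u S) (bigD1 k) //= [in RHS](bigD1 k) //=.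
by rewrite (eq_bigr _ others) => /addIr.
Qed.

End Uniqueness.

Theorem theorem4p1 (R : realType) (U : choiceType)
    (hU : ([set: U]%classic #= [set: nat]%classic)%card) :
  (exists! Phi : value_family R U, value_axioms Phi) /\
  (forall Phi : value_family R U, value_axioms Phi ->
   forall (N : {fset U}) (v : game R N) (i : N),
     unique (fun f : {set N} -> R => f finset.set0 = 0 /\ poisson v i f)
            (fun S => Phi N v S i)).
Proof.
split=> [|Phi axPhi N v i].
  exists (@poisson_value R U); split=> [|Phi axPhi].
    exact: poisson_value_axioms.
  apply: functional_extensionality_dep => N; apply/funext => v; apply/funext => S.
  apply/ffunP => i; apply: value_axioms_eq axPhi _ _ _ _.
  exact: poisson_value_axioms.
have PhiE S : Phi N v S i = flow_potential v i S.
  have := value_axioms_eq axPhi (@poisson_value_axioms R U) v S i.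
  by rewrite ffunE.
have -> : (fun S => Phi N v S i) = flow_potential v i by apply/funext.
split=> [|f [f0 /poissonP fP]].
  by split; [exact: flow_potential0 | apply/poissonP/laplacian_flow_potential].
by apply/funext => S; apply: flow_potentialP.
Qed.
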